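(* Let $p>2$ be a prime and let $[a_0,\dots,a_{t-1}]$ ($t\ge1$) be a nice finite Browkin continued fraction, and put $k_0=-v_p(a_0)$. Then there exist infinitely many $a_t\in\mathcal{Y}$ such that the periodic continued fraction $[a_0,\overline{a_1,\dots,a_{t-1},a_t,a_{t-1},\dots,a_1,2a_0}]$ (for $t=1$ this is $[a_0,\overline{a_1,2a_0}]$) converges in $\mathbb{Q}_p$ to a quadratic irrational of the form $\frac{1}{p^{k_0}\sqrt m}$ for some $m\in\mathbb{Z}$ (with $\sqrt m$ a square root of $m$ in $\mathbb{Q}_p$). Moreover, such $a_t$ can be chosen of the form $a_t=2c_t$ with $c_t\in\mathcal{Y}$.
   Context: Let $\mathcal{Y}=\mathbb{Z}[1/p]\cap(-p/2,p/2)$. A finite Browkin continued fraction $[a_0,\dots,a_{t-1}]$ is a sequence of elements of $\mathcal{Y}$ with $|a_i|_p>1$ for $1\le i\le t-1$. Its convergent sequences are $A_{-1}=1$, $A_0=a_0$, $B_{-1}=0$, $B_0=1$, $A_n=a_nA_{n-1}+A_{n-2}$, $B_n=a_nB_{n-1}+B_{n-2}$. For nonzero $x\in\mathbb{Z}[1/p]$, $\tilde x=x\,p^{-v_p(x)}\in\mathbb{Z}$. The finite BCF is nice if: (a) $|a_0|_p>1$ and $|a_0|_\infty<\frac p4$; (b) $\left|\frac{A_{t-1}}{A_{t-2}}\right|_\infty>\frac4p$; (c) there exists an integer $q$ with $\tilde B_{t-1}\mid q\mid\tilde B_{t-1}^2$ whose class modulo $\tilde A_{t-1}^2$ belongs to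 the multiplicative subgroup generated by the class of $p$. For an infinite sequence $(a_n)$ in $\mathbb{Z}[1/p]$, the value of $[a_0,a_1,\dots]$ is the $p$-adic limit of $A_n/B_n$; the overline denotes the repeating block. *)

(* Defs.v *)
From HB Require Import structures.
From mathcomp Require Import all_boot all_order all_algebra.
From mathcomp Require Import boolp classical_sets cardinality.

Set Implicit Arguments.
Unset Strict Implicit.
Unset Printing Implicit Defensive.

Import Order.TTheory GRing.Theory Num.Theory.
Local Open Scope ring_scope.

(** * The field Q_p, as the fraction field of Z_p = lim Z/p^n *)

(* A p-adic integer is the coherent sequence of its residues modulo p^n,
   each represented in {0, ..., p^n - 1} (coherence forces this range). *)
Record padic_seq (p : nat) := PadicSeq {
  residue :> nat -> nat;
  residue_coh : forall n, residue n = (residue n.+1 %% p ^ n)%N }.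

Definition padic_int (p : nat) (p_pr : prime p) := padic_seq p.

HB.instance Definition _ p (p_pr : prime p) := gen_eqMixin (padic_int p_pr).
HB.instance Definition _ p (p_pr : prime p) := gen_choiceMixin (padic_int p_pr).

Section PadicInt.
Variables (p : nat) (p_pr : prime p).
Local Notation Zp := (padic_int p_pr).
Implicit Types x y z : Zp.

Lemma padic_int_eq x y : (forall n, residue x n = residue y n) -> x = y.
Proof.
case: x y => [f fP] [g gP] /= /funext fg; case: _ / fg in gP *.
by congr PadicSeq; apply: Prop_irrelevance.
Qed.

Lemma residue_mod x n : (residue x n %% p ^ n = residue x n)%N.
Proof. by rewrite residue_coh modn_mod. Qed.

Lemma residue_modS (c n : nat) : (c %% p ^ n.+1 %% p ^ n = c %% p ^ n)%N.
Proof. by rewrite modn_dvdm // dvdn_exp2l. Qed.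

Lemma residue_le x m n : (m <= n)%N -> (residue x n %% p ^ m = residue x m)%N.
Proof.
move=> /subnK <-; elim: (n - m)%N => [|k IH]; first exact: residue_mod.
by rewrite -IH addSn [in RHS]residue_coh modn_dvdm // dvdn_exp2l ?leq_addl.
Qed.

Lemma padic_nat_coh (c n : nat) : (c %% p ^ n = c %% p ^ n.+1 %% p ^ n)%N.
Proof. by rewrite residue_modS. Qed.
Definition padic_nat (c : nat) : Zp :=
  @PadicSeq p (fun n => c %% p ^ n)%N (padic_nat_coh c).

Lemma padic_add_coh x y n :
  ((residue x n + residue y n) %% p ^ n =
   (residue x n.+1 + residue y n.+1) %% p ^ n.+1 %% p ^ n)%N.
Proof. by rewrite residue_modS (residue_coh x) (residue_coh y) modnDm. Qed.
Definition padic_add x y : Zp := PadicSeq (padic_add_coh x y).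

Lemma padic_mul_coh x y n :
  ((residue x n * residue y n) %% p ^ n =
   (residue x n.+1 * residue y n.+1) %% p ^ n.+1 %% p ^ n)%N.
Proof. by rewrite residue_modS (residue_coh x) (residue_coh y) modnMm. Qed.
Definition padic_mul x y : Zp := PadicSeq (padic_mul_coh x y).

(* -1 is represented by p^n - 1 modulo p^n *)
Lemma padic_opp_coh x n :
  (((p ^ n).-1 * residue x n) %% p ^ n =
   ((p ^ n.+1).-1 * residue x n.+1) %% p ^ n.+1 %% p ^ n)%N.
Proof.
rewrite residue_modS (residue_coh x) modnMmr; apply/eqP.
set c := residue x n.+1; rewrite -(eqn_modDr c) -![(_.-1 * c + c)%N]addnC -!mulSn.
rewrite !prednK ?expn_gt0 ?prime_gt0 // modnMr.
by rewrite eq_sym; apply: dvdn_mulr; rewrite dvdn_exp2l.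
Qed.
Definition padic_opp x : Zp := PadicSeq (padic_opp_coh x).

Lemma padic_addA : associative padic_add.
Proof. by move=> x y z; apply: padic_int_eq => n /=; rewrite modnDml modnDmr addnA. Qed.

Lemma padic_addC : commutative padic_add.
Proof. by move=> x y; apply: padic_int_eq => n /=; rewrite addnC. Qed.

Lemma padic_add0 : left_id (padic_nat 0) padic_add.
Proof. by move=> x; apply: padic_int_eq => n /=; rewrite mod0n residue_mod. Qed.

Lemma padic_addN : left_inverse (padic_nat 0) padic_opp padic_add.
Proof.
move=> x; apply: padic_int_eq => n /=; rewrite modnDml addnC -mulSn.
by rewrite prednK ?expn_gt0 ?prime_gt0 // modnMr mod0n.
Qed.

HB.instance Definition _ :=
  GRing.isZmodule.Build Zp padic_addA padic_addC padic_add0 padic_addN.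

Lemma padic_mulA : associative padic_mul.
Proof. by move=> x y z; apply: padic_int_eq => n /=; rewrite modnMml modnMmr mulnA. Qed.

Lemma padic_mulC : commutative padic_mul.
Proof. by move=> x y; apply: padic_int_eq => n /=; rewrite mulnC. Qed.

Lemma padic_mul1 : left_id (padic_nat 1) padic_mul.
Proof. by move=> x; apply: padic_int_eq => n /=; rewrite modnMml mul1n residue_mod. Qed.

Lemma padic_mulDl : left_distributive padic_mul padic_add.
Proof.
by move=> x y z; apply: padic_int_eq => n /=; rewrite modnMml modnDml modnDmr mulnDl.
Qed.

Lemma padic_one_neq0 : padic_nat 1 != padic_nat 0.
Proof.
apply/eqP => /(congr1 (fun x : Zp => residue x 1)) /=.
by rewrite expn1 mod0n modn_small ?prime_gt1.
Qed.

HB.instance Definition _ := GRing.Zmodule_isComNzRing.Build Zp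
  padic_mulA padic_mulC padic_mul1 padic_mulDl padic_one_neq0.

Definition padic_unit : pred Zp := fun x => `[< exists y, y * x = 1 >].
Definition padic_inv x : Zp :=
  if pselect (exists y, y * x = 1) is left xU then sval (cid xU) else x.

Lemma padic_mulV : {in padic_unit, left_inverse 1 padic_inv *%R}.
Proof.
move=> x /asboolP xU; rewrite /padic_inv.
by case: pselect => // xU'; case: cid.
Qed.

Lemma padic_unitP x y : y * x = 1 -> padic_unit x.
Proof. by move=> yx; apply/asboolP; exists y. Qed.

Lemma padic_inv_out : {in [predC padic_unit], padic_inv =1 id}.
Proof.
by move=> x /asboolP xNU; rewrite /padic_inv; case: pselect => // /xNU.
Qed.

HB.instance Definition _ :=
  GRing.ComNzRing_hasMulInverse.Build Zp padic_mulV padic_unitP padic_inv_out.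

Lemma padic_neq0 x : x != 0 -> exists n, ~~ (p ^ n %| residue x n)%N.
Proof.
move=> x0; apply/not_existsP => x_dvd; move/eqP: x0; apply.
apply: padic_int_eq => n /=; rewrite mod0n -residue_mod.
by apply/eqP/negPn/negP; apply: x_dvd.
Qed.

Lemma padic_idomain : GRing.integral_domain_axiom Zp.
Proof.
move=> x y xy0; apply/norP => -[/padic_neq0[m xm] /padic_neq0[n yn]].
set N := (m + n)%N.
have {}xm : ~~ (p ^ m %| residue x N)%N.
  by rewrite /dvdn residue_le ?leq_addr // -[residue x m]residue_mod.
have {}yn : ~~ (p ^ n %| residue y N)%N.
  by rewrite /dvdn residue_le ?leq_addl // -[residue y n]residue_mod.
have x0 : (0 < residue x N)%N by case: residue xm => //; rewrite dvdn0.
have y0 : (0 < residue y N)%N by case: residue yn => //; rewrite dvdn0.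
move: (congr1 (fun z : Zp => residue z N) xy0) => /= /eqP.
rewrite mod0n -/(dvdn _ _) pfactor_dvdn ?muln_gt0 ?x0 // lognM //.
move: xm yn; rewrite !pfactor_dvdn // -!ltnNge => xm yn.
by rewrite leqNgt -addSn leq_add // ltnW.
Qed.

HB.instance Definition _ :=
  GRing.ComUnitRing_isIntegral.Build Zp padic_idomain.

End PadicInt.

Definition padic (p : nat) (p_pr : prime p) : fieldType :=
  {fraction (padic_int p_pr)}.

Definition padic_of_int (p : nat) (p_pr : prime p) (z : padic_int p_pr) :
  padic p_pr := tofrac z.

(* Limits for the p-adic topology of Q_p, in which the subgroups p^N Z_p form
   a basis of neighbourhoods of 0. *)
Definition padic_cvg (p : nat) (p_pr : prime p)
    (u : nat -> padic p_pr) (l : padic p_pr) : Prop :=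
  forall N : nat, exists n0 : nat, forall n : nat, (n0 <= n)%N ->
    exists z : padic_int p_pr, u n - l = p%:R ^+ N * padic_of_int z.

Definition quadratic_irrational (p : nat) (p_pr : prime p)
    (x : padic p_pr) : Prop :=
  (forall r : rat, x <> ratr r) /\
  exists P : {poly rat}, size P = 3%N /\ root (map_poly ratr P) x.

(** * p-adic valuation and absolute value on Q *)

(* Junk value 0 at x = 0. *)
Definition padic_val (p : nat) (x : rat) : int :=
  (logn p `|numq x|)%:Z - (logn p `|denq x|)%:Z.

Definition padic_abs (p : nat) (x : rat) : rat :=
  if x == 0 then 0 else p%:R ^ (- padic_val p x).

Definition Z_inv_p (p : nat) (x : rat) : Prop :=
  exists (z : int) (k : nat), x = z%:~R / p%:R ^+ k.

(* For x <> 0 in Z[1/p] the rational x p^(-v_p(x)) is an integer, hence equal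
   to its numerator. *)
Definition prime_to_p_part (p : nat) (x : rat) : int :=
  numq (x * p%:R ^ (- padic_val p x)).

(** * Continued fractions *)

(* Indices are shifted by one: cf_num a n is A_(n-1) and cf_den a n is B_(n-1). *)
Fixpoint cf_num (a : nat -> rat) (n : nat) : rat :=
  match n with
  | 0 => 1
  | n1.+1 => match n1 with
             | 0 => a 0%N
             | n2.+1 => a n1 * cf_num a n1 + cf_num a n2
             end
  end.

Fixpoint cf_den (a : nat -> rat) (n : nat) : rat :=
  match n with
  | 0 => 0
  | n1.+1 => match n1 with
             | 0 => 1
             | n2.+1 => a n1 * cf_den a n1 + cf_den a n2
             end
  end.

Definition cf_value (p : nat) (p_pr : prime p)
    (a : nat -> rat) (l : padic p_pr) : Prop :=
  (forall n, cf_den a n.+1 != 0) /\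
  padic_cvg (fun n => ratr (cf_num a n.+1 / cf_den a n.+1)) l.

(* Partial quotients of [pre, overline{per}]; per is meant to be nonempty. *)
Definition periodic_cf (pre per : seq rat) (n : nat) : rat :=
  if (n < size pre)%N then pre`_n else per`_((n - size pre) %% size per).

Definition browkin_set (p : nat) (x : rat) : Prop :=
  Z_inv_p p x /\ - (p%:R / 2) < x < p%:R / 2.

Definition finite_BCF (p : nat) (s : seq rat) : Prop :=
  (forall i, (i < size s)%N -> browkin_set p s`_i) /\
  (forall i, (0 < i < size s)%N -> 1 < padic_abs p s`_i).

(* q lies in {p^k : k in Z} modulo N, for N prime to p: q = p^(i-j) mod N. *)
Definition in_powers_mod (p : nat) (N q : int) : Prop :=
  exists i j : nat, (q * p%:Z ^+ j = p%:Z ^+ i %[mod N])%Z.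

Definition nice_BCF (p : nat) (s : seq rat) : Prop :=
  let t := size s in
  let A := prime_to_p_part p (cf_num (nth 0 s) t) in
  let B := prime_to_p_part p (cf_den (nth 0 s) t) in
  [/\ 1 < padic_abs p s`_0 /\ `|s`_0| < p%:R / 4,
      4 / p%:R < `|cf_num (nth 0 s) t / cf_num (nth 0 s) t.-1| &
      exists q : int, [/\ (B %| q)%Z, (q %| B ^+ 2)%Z &
                          in_powers_mod p (A ^+ 2) q]].

(* [a_0, overline{a_1, ..., a_(t-1), b, a_(t-1), ..., a_1, 2 a_0}] *)
Definition symmetric_cf (s : seq rat) (b : rat) : nat -> rat :=
  periodic_cf [:: s`_0] (behead s ++ b :: rev (behead s) ++ [:: 2 * s`_0]).

Definition cvg_to_inv_sqrt (p : nat) (p_pr : prime p)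
    (a : nat -> rat) (k : int) : Prop :=
  exists x : padic p_pr, [/\ cf_value a x, quadratic_irrational x &
    exists (m : int) (s : padic p_pr),
      s ^+ 2 = m%:~R /\ x = 1 / (p%:R ^ k * s)].

(* Main.v *)
Require Import Defs.
From HB Require Import structures.
From mathcomp Require Import all_boot all_order all_algebra.
From mathcomp Require Import boolp classical_sets cardinality.
From mathcomp Require Import cyclic ring lra zify.
Import Order.TTheory GRing.Theory Num.Theory.
Local Open Scope classical_set_scope.
Local Open Scope ring_scope.

(* Let A/B and A'/B' be the last two convergents of [a_0, ..., a_(t-1)], and let
   M be the symmetric product of the matrices [[a, 1], [1, 0]] over the word
   a_0, ..., a_(t-1), b, a_(t-1), ..., a_0.  One period of the expansion acts on
   the vectors (A_n, B_n) by M [[0, 1], [1, 0]], of determinant 1, and hence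
   preserves the quadratic form R A_n^2 - P B_n^2, where
   P = A (b A + 2 A') and R = B (b B + 2 B') are the diagonal entries of M.
   As |B_n|_p tends to infinity, the value x satisfies R x^2 = P.

   For b = 2 c put e = c A + A', so that c B + B' = (e B + delta) / A with
   delta = A B' - A' B = +-1.  The choice e = - delta q / (p^L B), where
   p^L = q modulo the square of the prime-to-p part of A, makes R / P an element
   of Z[1/p], and thus p^(2 k_0) times an integer, as |R / P|_p = p^(-2 k_0).
   There are arbitrarily large such L, and then |c| is close to |A' / A| < p/4
   while |c|_p is large.  Up to squares R / P is q (q - p^L), which is not a
   square once p^L > 3 |q|. *)

Set Implicit Arguments.
Unset Strict Implicit.
Unset Printing Implicit Defensive.

(** * The p-adic absolute value on the rationals *)

(** The fraction a / b need not be reduced, while [padic_val] and [ratr] read the reduced one;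
    cross-multiplication relates the two without a gcd. *)
Lemma numq_cross_denq (a b : int) (x := a%:~R / b%:~R : rat) : b != 0 ->
  numq x * b = a * denq x.
Proof.
move=> b0; have bR0 : b%:~R != 0 :> rat by rewrite intr_eq0.
apply: (@intr_inj rat); rewrite !rmorphM /= -[in RHS](divfK bR0 a%:~R) -/x.
by rewrite -[x in x * b%:~R * _]divq_num_den; field; rewrite intr_eq0 denq_neq0.
Qed.

Section PadicAbs.
Variables (p : nat) (p_pr : prime p).
Implicit Types (x y : rat) (a b : int).
Local Notation pabs := (padic_abs p).

Let p_gt0 : 0 < p%:R :> rat. Proof. by rewrite ltr0n prime_gt0. Qed.
Let p_neq0 : p%:R != 0 :> rat. Proof. by rewrite lt0r_neq0. Qed.
Let p_gt1 : 1 < p%:R :> rat. Proof. by rewrite ltr1n prime_gt1. Qed.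

Lemma padic_val_frac a b : a != 0 -> b != 0 ->
  padic_val p (a%:~R / b%:~R) = (logn p `|a|)%:Z - (logn p `|b|)%:Z.
Proof.
move=> a0 b0; rewrite /padic_val; set x := _ / _.
have x0 : x != 0 by rewrite mulf_neq0 ?invr_eq0 ?intr_eq0.
have /(congr1 (fun z => logn p `|z|%N)) : numq x * b = a * denq x.
  exact: numq_cross_denq.
by rewrite !abszM !lognM ?absz_gt0 ?numq_eq0 ?denq_neq0 // => e; lia.
Qed.

Lemma padic_abs0 : pabs 0 = 0.
Proof. by rewrite /padic_abs eqxx. Qed.

Lemma padic_abs_int a : a != 0 -> pabs a%:~R = p%:R ^- logn p `|a|.
Proof.
move=> a0; rewrite /padic_abs intr_eq0 (negPf a0) -[a%:~R]divr1.
by rewrite (padic_val_frac (b := 1)) // logn1 subr0 -exprnN.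
Qed.

Lemma padic_abs_neq0 x : x != 0 -> pabs x = p%:R ^ (- padic_val p x).
Proof. by rewrite /padic_abs => /negPf ->. Qed.

Lemma padic_abs_gt0 x : x != 0 -> 0 < pabs x.
Proof. by move=> x0; rewrite padic_abs_neq0 // exprz_gt0. Qed.

Lemma padic_abs_ge0 x : 0 <= pabs x.
Proof.
by have [->|x0] := eqVneq x 0; [rewrite padic_abs0|rewrite ltW ?padic_abs_gt0].
Qed.

Lemma padic_abs_eq0 x : (pabs x == 0) = (x == 0).
Proof.
have [->|x0] := eqVneq x 0; first by rewrite padic_abs0 eqxx.
by rewrite gt_eqF ?padic_abs_gt0.
Qed.

Lemma padic_absM x y : pabs (x * y) = pabs x * pabs y.
Proof.
have [->|x0] := eqVneq x 0; first by rewrite mul0r padic_abs0 mul0r.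
have [->|y0] := eqVneq y 0; first by rewrite mulr0 padic_abs0 mulr0.
rewrite !padic_abs_neq0 ?mulf_neq0 // -expfzDr // -opprD; congr (_ ^ (- _)).
have -> : x * y = (numq x * numq y)%:~R / (denq x * denq y)%:~R.
  rewrite -[x in LHS]divq_num_den -[y in LHS]divq_num_den !rmorphM /=.
  by field; rewrite !intr_eq0 !denq_neq0.
rewrite padic_val_frac ?mulf_neq0 ?numq_eq0 ?denq_neq0 // /padic_val.
by rewrite !abszM !lognM ?absz_gt0 ?numq_eq0 ?denq_neq0 //; lia.
Qed.

Lemma padic_abs1 : pabs 1 = 1.
Proof. by rewrite (@padic_abs_int 1) // logn1 expr0 invr1. Qed.

Lemma padic_absN x : pabs (- x) = pabs x.
Proof.
by rewrite -mulN1r padic_absM (@padic_abs_int (-1)) // logn1 expr0 invr1 mul1r.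
Qed.

Lemma padic_absV x : pabs x^-1 = (pabs x)^-1.
Proof.
have [->|x0] := eqVneq x 0; first by rewrite !(invr0, padic_abs0).
have ax0 : pabs x != 0 by rewrite padic_abs_eq0.
by apply: (mulIf ax0); rewrite -padic_absM !mulVf // padic_abs1.
Qed.

Lemma padic_absX x n : pabs (x ^+ n) = pabs x ^+ n.
Proof. by elim: n => [|n IH]; rewrite ?expr0 ?padic_abs1 // !exprS padic_absM IH. Qed.

Lemma padic_abs_p : pabs p%:R = p%:R^-1.
Proof.
rewrite pmulrn padic_abs_int ?absz_nat ?logn_prime ?eqxx //.
by rewrite -lt0n prime_gt0.
Qed.

Lemma padic_abs_pz (k : int) : pabs (p%:R ^ k) = p%:R ^ (- k).
Proof.
case: k => n; first by rewrite padic_absX padic_abs_p exprVn -exprnN.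
by rewrite NegzE opprK -exprnN padic_absV padic_absX padic_abs_p exprVn invrK.
Qed.

Lemma padic_abs_int_le a (k : nat) :
  (pabs a%:~R <= p%:R ^- k) = (p%:Z ^+ k %| a)%Z.
Proof.
have [->|a0] := eqVneq a 0; first by rewrite padic_abs0 dvdz0 invr_ge0 exprn_ge0 ?ltW.
rewrite padic_abs_int // lef_pV2 ?posrE ?exprn_gt0 // ler_eXn2l //.
by rewrite -pfactor_dvdn ?absz_gt0 // dvdzE abszX.
Qed.

Lemma padic_abs_int_le1 a : pabs a%:~R <= 1.
Proof.
by have := padic_abs_int_le a 0; rewrite expr0 invr1 => ->; rewrite expr0 dvd1z.
Qed.

Lemma padic_abs_int_eq1 a : ~~ (p%:Z %| a)%Z -> pabs a%:~R = 1.
Proof.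
move=> pa; have a0 : a != 0 by apply: contraNneq pa => ->; rewrite dvdz0.
by rewrite padic_abs_int // logn_coprime ?invr1 // prime_coprime.
Qed.

(** For integers, a bound p^(-k) means divisibility by p^k, which is stable under addition. *)
Lemma padic_abs_intD a b : pabs ((a + b)%:~R) <= Num.max (pabs a%:~R) (pabs b%:~R).
Proof.
wlog ab : a b / pabs a%:~R <= pabs b%:~R => [H|].
  by case/orP: (le_total (pabs a%:~R) (pabs b%:~R)) => /H //; rewrite addrC maxC.
rewrite (max_idPr ab); have [b0|b0] := eqVneq b 0.
  by move: ab; rewrite b0 padic_abs0 addr0.
move: ab; rewrite (@padic_abs_int b) // !padic_abs_int_le => ab.
by rewrite rpredD // -padic_abs_int_le -padic_abs_int.
Qed.

Lemma padic_absD x y : pabs (x + y) <= Num.max (pabs x) (pabs y).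
Proof.
pose d := denq x * denq y.
have d0 : d%:~R != 0 :> rat by rewrite intr_eq0 mulf_neq0 ?denq_neq0.
have -> : x = (numq x * denq y)%:~R / d%:~R.
  rewrite -{1}[x]divq_num_den !rmorphM /=.
  by field; rewrite !intr_eq0 !denq_neq0.
have -> : y = (numq y * denq x)%:~R / d%:~R.
  rewrite -{1}[y]divq_num_den !rmorphM /=.
  by field; rewrite !intr_eq0 !denq_neq0.
rewrite -mulrDl -rmorphD /= ![pabs (_ / _)]padic_absM -maxr_pMl ?padic_abs_ge0 //.
by rewrite ler_wpM2r ?padic_abs_ge0 ?padic_abs_intD.
Qed.

Lemma padic_absD_le (c : rat) x y : pabs x <= c -> pabs y <= c -> pabs (x + y) <= c.
Proof. by move=> xc yc; apply: le_trans (padic_absD x y) _; rewrite ge_max xc. Qed.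

Lemma padic_absDl x y : pabs y < pabs x -> pabs (x + y) = pabs x.
Proof.
move=> yx; apply/le_anti/andP; split; first by rewrite padic_absD_le ?(ltW yx).
have := padic_absD (x + y) (- y); rewrite addrK padic_absN le_max.
by rewrite (leNgt (pabs x) (pabs y)) yx orbF.
Qed.

(* The absolute value takes its nonzero values in the powers of [p]. *)
Lemma padic_abs_gt1 x : 1 < pabs x -> p%:R <= pabs x.
Proof.
have [->|x0] := eqVneq x 0; first by rewrite padic_abs0 ltr10.
rewrite padic_abs_neq0 //; case: (- _) => [[|n]|n].
- by rewrite expr0z ltxx.
- by rewrite -exprnP -{2}[p%:R]expr1 ler_eXn2l.
by rewrite NegzE -exprnN ltNge invf_le1 ?exprn_gt0 // exprn_ege1 // ltW.
Qed.

End PadicAbs.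

(** * The ring Z[1/p] and the embedding of Q in Q_p *)

Section ZInvP.
Variables (p : nat) (p_pr : prime p).
Implicit Types (x y : rat) (a b : int).

Let p_gt0 : 0 < p%:R :> rat. Proof. by rewrite ltr0n prime_gt0. Qed.
Let p_neq0 : p%:R != 0 :> rat. Proof. by rewrite lt0r_neq0. Qed.

Lemma Z_inv_p_int a : Z_inv_p p a%:~R.
Proof. by exists a, 0%N; rewrite expr0 divr1. Qed.

Lemma Z_inv_pN x : Z_inv_p p x -> Z_inv_p p (- x).
Proof. by move=> [a [k ->]]; exists (- a), k; rewrite rmorphN mulNr. Qed.

Lemma Z_inv_pD x y : Z_inv_p p x -> Z_inv_p p y -> Z_inv_p p (x + y).
Proof.
move=> [a [k ->]] [b [l ->]]; exists (a * p%:Z ^+ l + b * p%:Z ^+ k), (k + l)%N.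
rewrite rmorphD !rmorphM /= !rmorphXn /= -!pmulrn exprD.
by field; rewrite !expf_neq0.
Qed.

Lemma Z_inv_pM x y : Z_inv_p p x -> Z_inv_p p y -> Z_inv_p p (x * y).
Proof.
move=> [a [k ->]] [b [l ->]]; exists (a * b), (k + l)%N.
by rewrite rmorphM /= exprD invfM mulrACA.
Qed.

Lemma Z_inv_p_pz (k : int) : Z_inv_p p (p%:R ^ k).
Proof.
case: k => n; last by exists 1, n.+1; rewrite mul1r NegzE -exprnN.
by exists (p%:Z ^+ n), 0%N; rewrite expr0 divr1 rmorphXn /= -pmulrn.
Qed.

(** The bound makes p^k divide the numerator. The integer m is finally found in this way. *)
Lemma Z_inv_p_integral x :
  Z_inv_p p x -> padic_abs p x <= 1 -> exists a, x = a%:~R.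
Proof.
move=> [a [k ->]]; rewrite padic_absM // padic_absV // padic_absX //.
rewrite padic_abs_p // exprVn invrK -ler_pdivlMr ?exprn_gt0 // mul1r.
rewrite padic_abs_int_le // => /dvdzP[b ->]; exists b.
by rewrite rmorphM rmorphXn /= -pmulrn mulfK ?expf_neq0.
Qed.

Lemma prime_to_p_partP x (xt := prime_to_p_part p x) : Z_inv_p p x -> x != 0 ->
  x = xt%:~R * p%:R ^ padic_val p x /\ ~~ (p%:Z %| xt)%Z.
Proof.
move=> xZ x0; set y := x * p%:R ^ (- padic_val p x).
have y1 : padic_abs p y = 1.
  by rewrite padic_absM // padic_abs_pz // padic_abs_neq0 // -expfzDr // subrr.
have [a ya] : exists a, y = a%:~R.
  by apply: Z_inv_p_integral; rewrite ?y1 //; apply/Z_inv_pM/Z_inv_p_pz.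
have xta : xt = a by rewrite /xt /prime_to_p_part -/y ya numq_int.
rewrite xta -ya /y -mulrA -expfzDr // addNr expr0z mulr1; split => //.
apply/negP; rewrite -[p%:Z]expr1 -padic_abs_int_le // -ya y1 expr1.
by rewrite leNgt invf_lt1 // ltr1n prime_gt1.
Qed.

End ZInvP.

(* MathComp only provides these facts for an ordered field. *)
Section RatrPchar0.
Variables (F : fieldType) (F0 : forall a : int, a != 0 -> a%:~R != 0 :> F).

Lemma pchar0_ratr_frac (a b : int) : b != 0 ->
  ratr (a%:~R / b%:~R) = a%:~R / b%:~R :> F.
Proof.
move=> b0; set x := _ / _.
have : numq x * b = a * denq x by exact: numq_cross_denq.
move/(congr1 (fun z => z%:~R : F)); rewrite !rmorphM /= => e.
apply/eqP; rewrite /ratr eqr_div ?F0 ?denq_neq0 //.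
by rewrite e.
Qed.

Lemma pchar0_ratrB : zmod_morphism (@ratr F).
Proof.
move=> x y; rewrite -[x in LHS]divq_num_den -[y in LHS]divq_num_den.
have -> : (numq x)%:~R / (denq x)%:~R - (numq y)%:~R / (denq y)%:~R =
    (numq x * denq y - numq y * denq x)%:~R / (denq x * denq y)%:~R :> rat.
  by rewrite rmorphB !rmorphM /=; field; rewrite !intr_eq0 !denq_neq0.
rewrite pchar0_ratr_frac ?mulf_neq0 ?denq_neq0 // rmorphB !rmorphM /=.
by rewrite /ratr; field; rewrite !F0 ?denq_neq0.
Qed.

Lemma pchar0_ratrM : monoid_morphism (@ratr F).
Proof.
split=> [|x y]; first by rewrite (ratr_nat _ 1).
rewrite -[x in LHS]divq_num_den -[y in LHS]divq_num_den.
have -> : (numq x)%:~R / (denq x)%:~R * ((numq y)%:~R / (denq y)%:~R) =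
    (numq x * numq y)%:~R / (denq x * denq y)%:~R :> rat.
  by rewrite !rmorphM /=; field; rewrite !intr_eq0 !denq_neq0.
rewrite pchar0_ratr_frac ?mulf_neq0 ?denq_neq0 // !rmorphM /=.
by rewrite /ratr; field; rewrite !F0 ?denq_neq0.
Qed.

End RatrPchar0.

(** * Divisibility by p and units in Z_p, and the field morphism from Q to Q_p *)

Section PadicField.
Variables (p : nat) (p_pr : prime p).
Local Notation Zp := (padic_int p_pr).
Local Notation Qp := (padic p_pr).

Lemma padic_natE (c : nat) : c%:R = padic_nat p_pr c :> Zp.
Proof.
elim: c => [|c IH]; first exact: padic_int_eq.
by rewrite -natr1 IH; apply: padic_int_eq => n /=; rewrite modnDm addn1.
Qed.

Lemma residue_nat (c n : nat) : residue (c%:R : Zp) n = (c %% p ^ n)%N.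
Proof. by rewrite padic_natE. Qed.

Lemma residueM (x y : Zp) n :
  residue (x * y) n = (residue x n * residue y n %% p ^ n)%N.
Proof. by []. Qed.

Lemma residueD (x y : Zp) n :
  residue (x + y) n = ((residue x n + residue y n) %% p ^ n)%N.
Proof. by []. Qed.

Lemma residue_Xp (x : Zp) n : residue (p%:R ^+ n * x) n = 0%N.
Proof.
by rewrite -natrX residueM residue_nat modnn mul0n mod0n.
Qed.

Lemma residue_eq0 (x : Zp) n : residue x n = 0%N -> exists y : Zp, x = p%:R ^+ n * y.
Proof.
move=> x0.
(* Division by p^n loses n digits, so the residue of the quotient modulo p^k is read off the residue
   modulo p^(k + n). *)
have coh k : (residue x (k + n) %/ p ^ n = (residue x (k.+1 + n) %/ p ^ n) %% p ^ k)%N.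
  by rewrite modn_divl -expnD residue_le ?addSn.
exists (PadicSeq coh); apply: padic_int_eq => k.
rewrite -natrX residueM residue_nat modnMml /=.
rewrite -(@residue_le _ _ x k (k + n)) ?leq_addr //.
rewrite mulnC divnK // /dvdn.
by rewrite residue_le ?leq_addl // x0.
Qed.

Lemma padic_nat_unit (w : nat) : ~~ (p %| w)%N -> exists y : Zp, y * w%:R = 1.
Proof.
move=> pw; have cw n : coprime w (p ^ n).
  by rewrite coprime_sym coprimeXl // prime_coprime.
(* By Euler's theorem this power inverts w modulo p^n; inverses modulo p^n are unique, which gives
   coherence. *)
pose v n := (w ^ (totient (p ^ n)).-1)%N.
have vP n : (v n * w = 1 %[mod p ^ n])%N.
  rewrite -expnSr prednK ?totient_gt0 ?expn_gt0 ?prime_gt0 //.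
  exact: Euler_exp_totient.
have coh n : (v n %% p ^ n = (v n.+1 %% p ^ n.+1) %% p ^ n)%N.
  have vP' : (v n.+1 * w = 1 %[mod p ^ n])%N by rewrite -residue_modS vP residue_modS.
  rewrite residue_modS -[v n]mul1n -modnMml -vP' modnMml -mulnA -modnMmr.
  by rewrite (mulnC w) vP modnMmr muln1.
exists (PadicSeq coh); apply: padic_int_eq => n.
by rewrite residueM residue_nat modnMml modnMmr vP.
Qed.

Lemma padic_natr_neq0 (c : nat) : c != 0%N -> c%:R != 0 :> Zp.
Proof.
(* The residue modulo p^c detects c, since c < p^c. *)
move=> c0; apply/eqP => /(congr1 (fun x : Zp => residue x c)).
rewrite residue_nat (_ : 0 = 0%:R) // residue_nat mod0n modn_small => [/eqP|].
  by rewrite (negPf c0).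
by rewrite ltn_expl ?prime_gt1.
Qed.

Lemma padic_intr_neq0 (a : int) : a != 0 -> a%:~R != 0 :> Qp.
Proof.
move=> a0; rewrite -(rmorph_int (@tofrac Zp)) tofrac_eq0.
case: a a0 => n a0; first exact: padic_natr_neq0.
by rewrite NegzE mulrNz oppr_eq0 padic_natr_neq0.
Qed.

(* A separate name, as MathComp already makes [ratr] itself a morphism into
   ordered fields. *)
Definition rat_padic (r : rat) : Qp := ratr r.

HB.instance Definition _ :=
  GRing.isZmodMorphism.Build rat Qp rat_padic (pchar0_ratrB padic_intr_neq0).
HB.instance Definition _ :=
  GRing.isMonoidMorphism.Build rat Qp rat_padic (pchar0_ratrM padic_intr_neq0).

End PadicField.

(** * Completeness of Q_p *)

Section PadicLimits.
Variables (p : nat) (p_pr : prime p).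
Local Notation Zp := (padic_int p_pr).
Local Notation Qp := (padic p_pr).
Local Notation rat_padic := (rat_padic p_pr).

Let p_neq0 : p%:R != 0 :> rat. Proof. by rewrite pnatr_eq0 -lt0n prime_gt0. Qed.

(** The condition that [padic_cvg] imposes on differences, isolated so that p-adic estimates become
    closure properties of p^N Z_p. *)
Definition in_pX_Zp (N : nat) (x : Qp) : Prop :=
  exists z : Zp, x = p%:R ^+ N * padic_of_int z.

Lemma in_pX_ZpD N x y : in_pX_Zp N x -> in_pX_Zp N y -> in_pX_Zp N (x + y).
Proof.
by move=> [z ->] [w ->]; exists (z + w); rewrite /padic_of_int rmorphD mulrDr.
Qed.

Lemma in_pX_ZpM N M x y :
  in_pX_Zp N x -> in_pX_Zp M y -> in_pX_Zp (N + M) (x * y).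
Proof.
move=> [z ->] [w ->]; exists (z * w).
by rewrite /padic_of_int rmorphM exprD mulrACA.
Qed.

Lemma in_pX_ZpN N x : in_pX_Zp N x -> in_pX_Zp N (- x).
Proof. by move=> [z ->]; exists (- z); rewrite /padic_of_int rmorphN mulrN. Qed.

Lemma in_pX_Zp_le N M x : (N <= M)%N -> in_pX_Zp M x -> in_pX_Zp N x.
Proof.
move=> /subnKC <- [z ->]; exists (p%:R ^+ (M - N) * z).
by rewrite /padic_of_int rmorphM rmorphXn rmorph_nat exprD mulrA.
Qed.

(** The topology is separated; the equation satisfied by a limit is proved through this. *)
Lemma in_pX_Zp_eq0 x : (forall N, in_pX_Zp N x) -> x = 0.
Proof.
move=> x_small; have [z xz] := x_small 0%N; rewrite expr0 mul1r in xz.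
suff z0 : z = 0 by rewrite xz z0 /padic_of_int rmorph0.
apply: padic_int_eq => N; have [w xw] := x_small N.
have -> : z = p%:R ^+ N * w.
  apply/eqP; rewrite -tofrac_eq rmorphM rmorphXn rmorph_nat.
  by rewrite -[tofrac z]xz xw.
by rewrite residue_Xp -(mulr0 (p%:R ^+ N)) residue_Xp.
Qed.

(** Transfers estimates from Q to Q_p: after division by p^N the denominator is prime to p, hence
    invertible in Z_p. *)
Lemma rat_padic_in_pX_Zp N r : padic_abs p r <= p%:R ^- N ->
  in_pX_Zp N (rat_padic r).
Proof.
move=> rN; pose r' := r / p%:R ^+ N.
have {rN} r'1 : padic_abs p r' <= 1.
  rewrite padic_absM // padic_absV // padic_absX // padic_abs_p // exprVn.
  rewrite invrK; apply: le_trans (ler_wpM2r _ rN) _; first by rewrite exprn_ge0.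
  by rewrite mulVf ?expf_neq0.
have -> : r = p%:R ^+ N * r' by rewrite mulrCA mulfV ?expf_neq0 ?mulr1.
rewrite rmorphM rmorphXn rmorph_nat; move: r' r'1 => r' r'1 {r}; set d := `|denq r'|%N.
(* If p divided the denominator, it would not divide the numerator, and the absolute value would
   exceed 1. *)
have pd : ~~ (p %| d)%N.
  apply/negP => pd; have pn : ~~ (p%:Z %| numq r')%Z.
    apply/negP; rewrite dvdzE => pn; have : (p %| gcdn `|numq r'| d)%N.
      by rewrite dvdn_gcd pn.
    by rewrite (eqP (coprime_num_den r')) Euclid_dvd1.
  move: r'1; rewrite -[r']divq_num_den padic_absM // padic_absV //.
  rewrite padic_abs_int_eq1 // mul1r invf_le1; last first.
    by rewrite padic_abs_gt0 // intr_eq0 denq_neq0.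
  apply/negP; rewrite -ltNge.
  have : (p%:Z ^+ 1 %| denq r')%Z by rewrite expr1 dvdzE.
  rewrite -padic_abs_int_le // => /le_lt_trans; apply.
  by rewrite expr1 invf_lt1 ?ltr1n ?ltr0n ?prime_gt1 ?prime_gt0.
have [y yd] := padic_nat_unit p_pr pd.
exists ((numq r')%:~R * y); congr (_ * _).
rewrite /padic_of_int rmorphM (rmorph_int (@tofrac Zp)) -[RHS]mulr1 -{1}[r']divq_num_den.
rewrite fmorph_div !rmorph_int -mulrA; congr (_ * _).
have dE : (denq r')%:~R = tofrac (d%:R : Zp) :> Qp.
  by rewrite rmorph_nat pmulrn /d absz_denq.
apply: (mulIf (x := (denq r')%:~R)); first by rewrite padic_intr_neq0 ?denq_neq0.
rewrite mulVf ?padic_intr_neq0 ?denq_neq0 // mulr1 dE -rmorphM /=.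
by rewrite yd rmorph1.
Qed.

(** The residue of u_m modulo p^n does not change for m >= n, so the diagonal residues form the
    limit. *)
Lemma padic_complete (u : nat -> rat) :
    (forall n, padic_abs p (u n) <= 1) ->
    (forall n, padic_abs p (u n.+1 - u n) <= p%:R ^- n) ->
  exists x : Qp, forall n, in_pX_Zp n (rat_padic (u n) - x).
Proof.
move=> u1 du; have /choice[w wP] n : exists w : Zp, rat_padic (u n) = tofrac w.
  have [|z ->] := @rat_padic_in_pX_Zp 0 (u n); first by rewrite expr0 invr1.
  by exists z; rewrite expr0 mul1r.
have dw n : residue (w n.+1) n = residue (w n) n.
  have [z] := rat_padic_in_pX_Zp (du n).
  rewrite rmorphB /= !wP -rmorphB => /eqP.
  rewrite /padic_of_int -(rmorph_nat (@tofrac Zp)) -rmorphXn -rmorphM tofrac_eq => /eqP e.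
  rewrite -[w n.+1](subrK (w n)) e residueD residue_Xp add0n.
  exact: residue_mod.
have coh n : residue (w n) n = (residue (w n.+1) n.+1 %% p ^ n)%N.
  by rewrite residue_le ?dw.
pose l : Zp := PadicSeq coh; exists (tofrac l) => n; rewrite wP -rmorphB.
have [|z ->] := @residue_eq0 _ p_pr (w n - l) n; last first.
  by exists z; rewrite rmorphM rmorphXn rmorph_nat.
have -> : residue (w n - l) n = residue (l - l) n by rewrite !residueD.
by rewrite subrr -(mulr0n 1) residue_nat mod0n.
Qed.

End PadicLimits.

(** * Convergents of continued fractions *)

(** Here v is a convergent, w = p^K and w^2 h the distance to the limit; each factor w is placed so
    as to clear the p-adic denominator of r or of v. *)
Lemma quadratic_shift (F : comPzRingType) (r v q w h : F) :
  r * (v - w * w * h) ^+ 2 - q =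
  r * v ^+ 2 - q - h * (w * r) * (w * (2 * v) - w * (w * w * h)).
Proof. by ring. Qed.

Section Convergents.
Implicit Types (a : nat -> rat) (n : nat).

Lemma cf_numS a n : cf_num a n.+2 = a n.+1 * cf_num a n.+1 + cf_num a n.
Proof. by []. Qed.

Lemma cf_denS a n : cf_den a n.+2 = a n.+1 * cf_den a n.+1 + cf_den a n.
Proof. by []. Qed.

Lemma cf_det a n : cf_num a n.+1 * cf_den a n - cf_num a n * cf_den a n.+1 =
  (-1) ^+ n.+1.
Proof.
elim: n => [|n IH]; first by rewrite /= !(mulr0, mulr1) add0r.
by rewrite exprS -IH /=; ring.
Qed.

Variables (p : nat) (p_pr : prime p).
Local Notation pabs := (padic_abs p).

Let p_gt0 : 0 < p%:R :> rat. Proof. by rewrite ltr0n prime_gt0. Qed.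

Lemma pabs_recurrence c x y : x != 0 -> pabs y <= pabs x -> 1 < pabs c ->
  pabs (c * x + y) = pabs c * pabs x.
Proof.
move=> x0 yx c1; rewrite padic_absDl ?padic_absM //.
by apply: le_lt_trans yx _; rewrite ltr_pMl ?padic_abs_gt0.
Qed.

(** Stated for an abstract [X] because numerators and denominators share the recurrence but not the
    initial values. *)
Lemma pabs_recurrence_incr (X : nat -> rat) a n :
    (forall i, X i.+2 = a i.+1 * X i.+1 + X i) ->
    X 1%N != 0 -> pabs (X 0%N) <= pabs (X 1%N) ->
    (forall i, (0 < i <= n)%N -> 1 < pabs (a i)) ->
  X n.+1 != 0 /\ pabs (X n) <= pabs (X n.+1).
Proof.
move=> XE X1 X01; elim: n => [//|n IH] a1.
have [|Xn0 Xle] := IH; first by move=> i /andP[i0 /leqW in1]; rewrite a1 ?i0.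
have an : 1 < pabs (a n.+1) by rewrite a1 /=.
have XnE : pabs (X n.+2) = pabs (a n.+1) * pabs (X n.+1).
  by rewrite XE pabs_recurrence.
split; last by rewrite XnE ler_peMl ?padic_abs_ge0 ?(ltW an).
rewrite -(padic_abs_eq0 p_pr) XnE gt_eqF // mulr_gt0 ?(lt_trans ltr01 an) //.
by rewrite padic_abs_gt0.
Qed.

Lemma cf_den_incr a n : (forall i, (0 < i <= n)%N -> 1 < pabs (a i)) ->
  cf_den a n.+1 != 0 /\ pabs (cf_den a n) <= pabs (cf_den a n.+1).
Proof.
by apply: pabs_recurrence_incr; rewrite //= padic_abs0 padic_abs_ge0.
Qed.

Lemma cf_num_incr a n : (forall i, (i <= n)%N -> 1 < pabs (a i)) ->
  cf_num a n.+1 != 0 /\ pabs (cf_num a n) <= pabs (cf_num a n.+1).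
Proof.
move=> a1; have a01 : 1 < pabs (a 0%N) by rewrite a1.
apply: (pabs_recurrence_incr (a := a)) => // [||i /andP[_]]; last exact: a1.
  by rewrite -(padic_abs_eq0 p_pr) gt_eqF // (lt_trans ltr01).
by rewrite padic_abs1 // ltW.
Qed.

(** Each step multiplies the absolute values of numerator and denominator by the same |a_n|_p, so
    their ratio stays |a_0|_p. *)
Lemma pabs_cf_num a n : (forall i, (i <= n)%N -> 1 < pabs (a i)) ->
  pabs (cf_num a n.+1) = pabs (a 0%N) * pabs (cf_den a n.+1).
Proof.
elim: n => [_|n IH a1]; first by rewrite padic_abs1 // mulr1.
have a1' i : (i <= n)%N -> 1 < pabs (a i) by move/leqW/a1.
have [num0 num_le] := cf_num_incr a1'.
have [|den0 den_le] := @cf_den_incr a n; first by move=> i /andP[_ /a1'].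
rewrite cf_numS cf_denS !pabs_recurrence ?a1 //.
by rewrite IH // mulrCA.
Qed.

Lemma pabs_cf_den_ge a n : (forall i, (0 < i <= n)%N -> 1 < pabs (a i)) ->
  p%:R ^+ n <= pabs (cf_den a n.+1).
Proof.
elim: n => [_|n IH a1]; first by rewrite padic_abs1.
have a1' i : (0 < i <= n)%N -> 1 < pabs (a i).
  by move=> /andP[i0 /leqW in1]; rewrite a1 ?i0.
have [den0 den_le] := cf_den_incr a1'.
rewrite cf_denS pabs_recurrence ?a1 ?leqnn // exprS.
by rewrite ler_pM ?exprn_ge0 ?ler0n ?IH ?padic_abs_gt1 ?a1 ?leqnn.
Qed.

(** Successive convergents differ by +-1 / (B_n B_(n+1)) by the determinant identity, and |B_n|_p >=
    p^n. The explicit rate of convergence is kept for [cf_limit_root]. *)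
Lemma cf_converges a : (forall i, (0 < i)%N -> 1 < pabs (a i)) ->
  exists x : padic p_pr, cf_value a x /\ forall n,
    in_pX_Zp n (rat_padic p_pr (cf_num a n.+1 / cf_den a n.+1) - x).
Proof.
move=> a1; have den0 n : cf_den a n.+1 != 0.
  by have [|//] := @cf_den_incr a n; move=> i /andP[/a1].
pose u n := cf_num a n.+1 / cf_den a n.+1.
have du n : pabs (u n.+1 - u n) <= p%:R ^- n.
  have -> : u n.+1 - u n = (-1) ^+ n.+2 / (cf_den a n.+2 * cf_den a n.+1).
    rewrite -(cf_det a n.+1) /u; move: (den0 n) (den0 n.+1).
    move: (cf_num a _) (cf_den a _) (cf_num a _) (cf_den a _) => x y z w w0 y0.
    by field; rewrite w0.
  rewrite padic_absM // padic_absV // padic_absX // padic_absM // padic_absN //.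
  rewrite padic_abs1 // expr1n mul1r lef_pV2 ?posrE ?exprn_gt0 //; last first.
    by rewrite mulr_gt0 ?padic_abs_gt0.
  have den_ge m : p%:R ^+ m <= pabs (cf_den a m.+1).
    by apply: pabs_cf_den_ge => i /andP[/a1].
  apply: le_trans (den_ge n) _; rewrite ler_peMl ?padic_abs_ge0 //.
  by apply: le_trans (den_ge n.+1); rewrite exprn_ege1 // ler1n prime_gt0.
(* Completeness is applied to p-adic integers, so a_0 is subtracted first and added back to the
   limit. *)
have u1 n : pabs (u n - a 0%N) <= 1.
  elim: n => [|n IH]; first by rewrite /u divr1 subrr padic_abs0.
  rewrite -(subrK (u n) (u n.+1)) -addrA padic_absD_le //.
  apply: le_trans (du n) _; rewrite invf_le1 ?exprn_gt0 //.
  by rewrite exprn_ege1 // ler1n prime_gt0.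
have [|x xP] := padic_complete p_pr u1.
  by move=> n; rewrite opprB addrA subrK.
have xP' n : in_pX_Zp n (rat_padic p_pr (u n) - (rat_padic p_pr (a 0%N) + x)).
  by rewrite opprD addrA -rmorphB.
exists (rat_padic p_pr (a 0%N) + x); split=> //; split=> // N.
by exists N => n Nn; apply: in_pX_Zp_le Nn (xP' n).
Qed.

Lemma ltr_exp_prime (x : rat) : exists n : nat, x < p%:R ^+ n.
Proof.
exists (Num.bound `|x|); apply: le_lt_trans (ler_norm x) _.
apply: lt_trans (archi_boundP (normr_ge0 x)) _.
by rewrite -natrX ltr_nat ltn_expl ?prime_gt1.
Qed.

Local Notation f := (rat_padic p_pr).

(** Division by B_n^2 turns the constant form into R u^2 - P = e / B_n^2, which tends to 0 along the
    given indices while u tends to x. *)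
Lemma cf_limit_root a (x : padic p_pr) (P R e : rat) :
    (forall i, 1 < pabs (a i)) ->
    (forall n, in_pX_Zp n (rat_padic p_pr (cf_num a n.+1 / cf_den a n.+1) - x)) ->
    (forall N, exists2 n, (N <= n)%N &
      R * cf_num a n.+1 ^+ 2 - P * cf_den a n.+1 ^+ 2 = e) ->
  rat_padic p_pr R * x ^+ 2 = rat_padic p_pr P.
Proof.
move=> a1 ux form.
(* One K serves for R, e and every convergent, since all convergents have absolute value |a_0|_p. *)
have [K] := ltr_exp_prime (pabs R + pabs (a 0%N) + pabs e).
move=> Kbig; have := padic_abs_ge0 p_pr e; have := padic_abs_ge0 p_pr R.
have := padic_abs_ge0 p_pr (a 0%N) => a0_ge0 R_ge0 e_ge0.
have RK : pabs R <= p%:R ^+ K by lra.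
have aK : pabs (a 0%N) <= p%:R ^+ K by lra.
have eK : pabs e <= p%:R ^+ K by lra.
apply/eqP; rewrite -subr_eq0; apply/eqP/in_pX_Zp_eq0 => N.
(* Past N + 2 K, the error u - x has p^(2 K) to spare for the denominators of R and u, and 1 / B_n^2
   is small enough to absorb e. *)
have [n Nn en] := form (N + (K + K))%N.
pose u := cf_num a n.+1 / cf_den a n.+1; pose h := f u - x.
have den0 : cf_den a n.+1 != 0 by have [] := @cf_den_incr a n.
have den_ge : p%:R ^+ n <= pabs (cf_den a n.+1) by apply: pabs_cf_den_ge.
have uK : pabs u <= p%:R ^+ K.
  rewrite padic_absM // padic_absV // pabs_cf_num // mulfK //.
  by rewrite padic_abs_eq0.
have [h' h'N hE] : exists2 h', in_pX_Zp N h' & h = p%:R ^+ (K + K) * h'.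
  have [z hz] := in_pX_Zp_le Nn (ux n).
  exists (p%:R ^+ N * padic_of_int z); first by exists z.
  by rewrite mulrA -exprD addnC.
have Ru : f (R * u ^+ 2 - P) = f (e / cf_den a n.+1 ^+ 2).
  by congr f; rewrite -en /u; field.
have -> : f R * x ^+ 2 - f P = f (R * u ^+ 2 - P)
    - h' * f (p%:R ^+ K * R) * (f (p%:R ^+ K * (2 * u)) - p%:R ^+ K * h).
  have -> : x = f u - h by rewrite /h opprB addrC subrK.
  rewrite hE exprD; move: u {uK h hE Ru} => u.
  by rewrite !(rmorphB, rmorphM, rmorphXn, rmorph_nat) /= quadratic_shift.
have pabs_pX (k : nat) r : pabs (p%:R ^+ k * r) = p%:R ^- k * pabs r.
  by rewrite padic_absM // padic_absX // padic_abs_p // exprVn.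
have small0 r : pabs r <= p%:R ^+ K -> in_pX_Zp 0 (f (p%:R ^+ K * r)).
  move=> rK; apply: rat_padic_in_pX_Zp.
  by rewrite pabs_pX expr0 invr1 mulrC ler_pdivrMr ?exprn_gt0 // mul1r.
apply: in_pX_ZpD; last first.
  apply: in_pX_ZpN; rewrite -[N]addn0 -[(N + 0)%N]addn0.
  apply: in_pX_ZpM; first by apply: in_pX_ZpM => //; apply: small0.
  apply: in_pX_ZpD.
    apply: small0; rewrite padic_absM //; apply: le_trans uK.
    rewrite ler_piMl ?padic_abs_ge0 //; exact: (padic_abs_int_le1 p_pr 2).
  rewrite hE; apply/in_pX_ZpN/(@in_pX_Zp_le _ _ _ (K + (K + K + N))) => //.
  have [z ->] := h'N; exists z.
  by rewrite !mulrA -!exprD !addnA.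
rewrite Ru; apply: rat_padic_in_pX_Zp.
rewrite padic_absM // padic_absV // padic_absX //.
rewrite ler_pdivrMr ?exprn_gt0 ?padic_abs_gt0 //.
apply: le_trans eK _; rewrite mulrC ler_pdivlMr ?exprn_gt0 // -exprD.
apply: (@le_trans _ _ (p%:R ^+ n)).
  by apply: ler_weXn2l; [rewrite ler1n prime_gt0 | lia].
apply: (le_trans den_ge); rewrite expr2 ler_peMl ?padic_abs_ge0 //.
by apply: le_trans den_ge; rewrite exprn_ege1 // ler1n prime_gt0.
Qed.

End Convergents.

(** * Symmetric expansions through products of 2 by 2 matrices *)

Section SymmetricExpansion.

Definition mx2 (x y z w : rat) : 'M[rat]_2 := \matrix_(i, j)
  if i == 0 then if j == 0 then x else y else if j == 0 then z else w.

Lemma mx2M x y z w x' y' z' w' : mx2 x y z w * mx2 x' y' z' w' =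
  mx2 (x * x' + y * z') (x * y' + y * w') (z * x' + w * z') (z * y' + w * w').
Proof.
by apply/matrixP => i j; rewrite !mxE !big_ord_recl big_ord0 addr0 !mxE /=;
  case: (i == 0); case: (j == 0).
Qed.

Lemma mx2_inj x y z w x' y' z' w' : mx2 x y z w = mx2 x' y' z' w' ->
  [/\ x = x', y = y', z = z' & w = w'].
Proof.
by move=> /matrixP e; split; [move: (e 0 0)|move: (e 0 1)|move: (e 1 0)|move: (e 1 1)];
  rewrite !mxE.
Qed.

Lemma trmx_mx2 x y z w : (mx2 x y z w)^T = mx2 x z y w.
Proof. by apply/matrixP => i j; rewrite !mxE; case: (i == 0); case: (j == 0). Qed.

Definition cf_mx (x : rat) : 'M[rat]_2 := mx2 x 1 1 0.

Lemma prod_cf_mx a n : \prod_(0 <= i < n.+1) cf_mx (a i) =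
  mx2 (cf_num a n.+1) (cf_num a n) (cf_den a n.+1) (cf_den a n).
Proof.
elim: n => [|n IH]; first by rewrite big_nat1.
rewrite big_nat_recr //= IH mx2M; congr mx2;
  by rewrite /= ?(mulr1, mulr0, addr0) // mulrC.
Qed.

(** Each [cf_mx x] is symmetric, so transposition only reverses the order of the factors. *)
Lemma prod_cf_mx_rev (s : seq rat) :
  \prod_(x <- rev s) cf_mx x = (\prod_(x <- s) cf_mx x)^T.
Proof.
elim: s => [|x s IH]; first by rewrite big_nil trmx1.
by rewrite rev_cons -cats1 big_cat big_seq1 IH big_cons trmx_mul trmx_mx2.
Qed.

(** The middle factor is [cf_mx 0]: of the word a_0, 0, a_0 replacing 2 a_0, the first a_0 completes
    a palindrome and the second starts the next one. *)
Lemma cf_mx_double x : cf_mx (2 * x) = cf_mx x * mx2 0 1 1 0 * cf_mx x.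
Proof. by rewrite !mx2M; congr mx2; ring. Qed.

Variables (s : seq rat) (b : rat).
Hypothesis s_nonempty : (0 < size s)%N.
Let t := size s.
Let A := cf_num (nth 0 s) t.
Let A' := cf_num (nth 0 s) t.-1.
Let B := cf_den (nth 0 s) t.
Let B' := cf_den (nth 0 s) t.-1.
Local Notation a := (symmetric_cf s b).

Let per := behead s ++ b :: rev (behead s) ++ [:: 2 * s`_0].

Lemma size_symmetric_period : size per = t.*2.
Proof.
rewrite /per /t; case: (s) s_nonempty => //= x l _.
by rewrite size_cat /= size_cat size_rev /= addn1 -addnn addnS addSn.
Qed.

Lemma symmetric_cf_periodic n : a (n.+1 + t.*2) = a n.+1.
Proof.
rewrite /symmetric_cf /periodic_cf -/per /= !subn1 /= size_symmetric_period.
by rewrite modnDr.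
Qed.

Lemma symmetric_cf_mem n : a n \in s ++ [:: b; 2 * s`_0].
Proof.
have per_mem : {subset s`_0 :: per <= s ++ [:: b; 2 * s`_0]}.
  rewrite /per; case: (s) s_nonempty => //= x l _ y.
  rewrite !(inE, mem_cat, mem_rev); case: (y == x) => //=.
  by case: (y \in l); rewrite ?orbT //= => /or3P[->|//|->]; rewrite ?orbT.
apply: per_mem; rewrite /symmetric_cf /periodic_cf -/per.
case: n => [|n] /=; first by rewrite mem_head.
by rewrite in_cons mem_nth ?orbT // ltn_pmod // size_symmetric_period double_gt0.
Qed.

Let P := A * (b * A + 2 * A').
Let Q := b * A * B + A * B' + A' * B.
Let R := B * (b * B + 2 * B').

(** The product of the first 2 t + 1 matrices is M [[0, 1], [1, 0]] times the matrix of a_0, where M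
    has rows (P, Q) and (Q, R). *)
Lemma symmetric_cf_period :
  [/\ cf_num a t.*2.+1 = Q * s`_0 + P, cf_num a t.*2 = Q,
      cf_den a t.*2.+1 = R * s`_0 + Q & cf_den a t.*2 = R].
Proof.
apply: mx2_inj; rewrite -prod_cf_mx.
have sE : s = s`_0 :: behead s by case: (s) s_nonempty.
have -> : \prod_(0 <= i < t.*2.+1) cf_mx (a i) =
    \prod_(x <- s ++ b :: rev (behead s) ++ [:: 2 * s`_0]) cf_mx x.
  have -> : s ++ b :: rev (behead s) ++ [:: 2 * s`_0] = s`_0 :: per.
    by rewrite {1}sE.
  rewrite big_nat_recl // big_cons; congr (_ * _).
  rewrite [RHS](big_nth 0) size_symmetric_period; apply: eq_big_nat => i /andP[_ it].
  by rewrite /symmetric_cf /periodic_cf /= -/per ?subn1 size_symmetric_period modn_small.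
have MP : \prod_(x <- s) cf_mx x = mx2 A A' B B'.
  have tE : t = t.-1.+1 by rewrite prednK.
  by rewrite (big_nth 0) -/t {1}tE prod_cf_mx -tE.
have MTP : \prod_(x <- rev (behead s)) cf_mx x * cf_mx s`_0 = mx2 A B A' B'.
  rewrite -trmx_mx2 -MP -prod_cf_mx_rev [in RHS]sE rev_cons -cats1.
  by rewrite big_cat big_seq1.
rewrite big_cat big_cons big_cat big_seq1 cf_mx_double /= MP.
rewrite [X in _ * (_ * X)]mulrA [X in _ * (_ * (X * _))]mulrA MTP !mx2M.
by congr mx2; rewrite /P /Q /R; ring.
Qed.

(** By periodicity both sides obey the same recurrence, so the two initial indices suffice;
    [symmetric_cf_period] supplies them. *)
Lemma symmetric_cf_shift n :
  cf_num a (n + t.*2) = Q * cf_num a n + P * cf_den a n /\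
  cf_den a (n + t.*2) = R * cf_num a n + Q * cf_den a n.
Proof.
have [nT1 nT dT1 dT] := symmetric_cf_period.
elim/ltn_ind: n => -[_|[_|n IH]]; first by rewrite /= nT dT !(mulr0, mulr1, addr0).
  by rewrite add1n nT1 dT1 /= !mulr1.
have [n0 d0] := IH n (leqnSn _); have [n1 d1] := IH n.+1 (leqnn _).
rewrite !addSn in n1 d1 *; rewrite !cf_numS !cf_denS n0 d0 n1 d1 -addSn.
by rewrite symmetric_cf_periodic; split; ring.
Qed.

Lemma symmetric_cf_form_invariant k :
  R * cf_num a (k * t.*2).+1 ^+ 2 - P * cf_den a (k * t.*2).+1 ^+ 2 =
  R * s`_0 ^+ 2 - P.
Proof.
have det2 : (A * B' - A' * B) ^+ 2 = 1.
  have := cf_det (nth 0 s) t.-1; rewrite prednK // => ->.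
  by rewrite -exprM mulnC exprM sqrrN !expr1n.
(* This is - det M: the two outer factors are transposes of each other with determinant +-1, and the
   matrix of b has determinant -1. *)
have QPR : Q ^+ 2 - P * R = 1 by rewrite -[RHS]det2 /P /Q /R; ring.
elim: k => [|k <-]; first by rewrite mul0n /= expr1n mulr1.
rewrite mulSn addnC -addSn; case: (symmetric_cf_shift (k * t.*2).+1) => -> ->.
move: (cf_num a _) (cf_den a _) P Q R QPR => x y u v w vuw.
by rewrite -[RHS]mul1r -vuw; ring.
Qed.

End SymmetricExpansion.

(** * Choice of the central partial quotient *)

Section Arithmetic.
Variables (p : nat) (p_pr : prime p).
Local Notation pabs := (padic_abs p).
Local Notation f := (rat_padic p_pr).

Let p_gt0 : 0 < p%:R :> rat. Proof. by rewrite ltr0n prime_gt0. Qed.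
Let p_neq0 : p%:R != 0 :> rat. Proof. by rewrite lt0r_neq0. Qed.
Let p_gt1 : 1 < p%:R :> rat. Proof. by rewrite ltr1n prime_gt1. Qed.

Lemma coprimez_prime (N : int) : coprimez N p = ~~ (p%:Z %| N)%Z.
Proof. by rewrite coprimezE coprime_sym /= prime_coprime // dvdzE. Qed.

Lemma power_congr_unbounded (N q : int) K : ~~ (p%:Z %| N)%Z ->
  in_powers_mod p N q -> exists2 L, (K <= L)%N & (N %| p%:Z ^+ L - q)%Z.
Proof.
rewrite -coprimez_prime => Np [i [j /eqP]]; rewrite eqz_mod_dvd => qij.
have N0 : (0 < `|N|)%N.
  rewrite absz_gt0; apply: contraTneq Np => ->.
  by rewrite coprimezE /coprime gcd0n neq_ltn prime_gt1 // orbT.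
(* By Euler's theorem p^(n m) = 1 modulo N, and n = K + j makes n m + i - j at least K. *)
pose m := totient `|N|; pose n := (K + j)%N.
have m0 : (0 < m)%N by rewrite totient_gt0.
have pm : (N %| p%:Z ^+ (n * m) - 1)%Z.
  rewrite -[p%:Z]natz -natrX -[1]/(1%:R : int) -natrB ?expn_gt0 ?prime_gt0 //.
  rewrite natz dvdzE /= -eqn_mod_dvd ?expn_gt0 ?prime_gt0 // expnM.
  apply/eqP/Euler_exp_totient; rewrite coprimeXl //.
  by move: Np; rewrite coprimezE coprime_sym.
exists (n * m + i - j)%N; first by nia.
(* The factor p^j, invertible modulo N, removes the subtraction from the exponent. *)
rewrite -(Gauss_dvdzr (m := N) (n := p%:Z ^+ j)) ?coprimezXr //.
rewrite mulrBr -exprD subnKC; last by nia.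
have -> : p%:Z ^+ (n * m + i) - p%:Z ^+ j * q =
    p%:Z ^+ i * (p%:Z ^+ (n * m) - 1) - (q * p%:Z ^+ j - p%:Z ^+ i).
  by rewrite exprD; ring.
by rewrite rpredB // dvdz_mull.
Qed.

Lemma rat_sqr_int (y : rat) (n : int) : y ^+ 2 = n%:~R -> exists z, n = z ^+ 2.
Proof.
move=> yn; have e : numq y ^+ 2 = n * denq y ^+ 2.
  apply: (@intr_inj rat); rewrite [in RHS]rmorphM !rmorphXn /= -yn -exprMn.
  by rewrite -{2}[y]divq_num_den divfK // intr_eq0 denq_neq0.
have d1 : denq y = 1.
  have : (`|denq y| %| `|numq y|)%N.
    by rewrite -(dvdn_pexp2r _ _ (k := 2)) // -!abszX e abszM dvdn_mull.
  move/gcdn_idPl; rewrite gcdnC (eqP (coprime_num_den y)) => d1.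
  by rewrite -absz_denq -d1.
by exists (numq y); rewrite e d1 expr1n mulr1.
Qed.

(* [p ^ L] must divide one of the factors of [(z - q) (z + q) = - q p ^ L];
   the other one then divides [q], which makes the first one too small. *)
Lemma shifted_square_not_square (q z : int) L : (2 < p)%N -> ~~ (p%:Z %| q)%Z ->
  3 * `|q| < p%:Z ^+ L -> z ^+ 2 != q * (q - p%:Z ^+ L).
Proof.
move=> p2 pq Lbig; apply/negP => /eqP zE.
(* The sign of z is free, and p cannot divide both z - q and - z - q, whose sum is - 2 q with p
   odd. *)
wlog pz : z zE / ~~ (p%:Z %| z - q)%Z => [H|].
  have [pzq|] := boolP (p%:Z %| z - q)%Z; last exact: H zE.
  apply: (H (- z)); first by rewrite sqrrN.
  apply/negP => pzq'; case/negP: pq; have : (p%:Z %| 2 * q)%Z.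
    have -> : 2 * q = - ((z - q) + (- z - q)) by ring.
    by rewrite rpredN rpredD.
  by rewrite Gauss_dvdzr // coprimezE /= prime_coprime // gtnNdvd.
have : (p%:Z ^+ L %| (z - q) * (z + q))%Z.
  apply/dvdzP; exists (- q); have -> : (z - q) * (z + q) = z ^+ 2 - q ^+ 2 by ring.
  by rewrite zE; ring.
rewrite Gauss_dvdzr; last first.
  by rewrite coprimezXl // /coprimez gcdzC -/(coprimez _ _) coprimez_prime.
case/dvdzP => w wE; have pL0 : p%:Z ^+ L != 0.
  by rewrite expf_neq0 // eqz_nat -lt0n prime_gt0.
have qE : (z - q) * w = - q.
  apply: (mulIf pL0); rewrite -mulrA -wE.
  have -> : (z - q) * (z + q) = z ^+ 2 - q ^+ 2 by ring.
  by rewrite zE; ring.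
have q0 : q != 0 by apply: contraNneq pq => ->; rewrite dvdz0.
have w0 : w != 0 by apply: contra_neq q0 => w0; move: qE; rewrite w0 mulr0; lia.
have w1 : 1 <= `|w| by rewrite -gtz0_ge1 normr_gt0.
have zq : `|z - q| <= `|q|.
  by rewrite -(normrN q) -[in leRHS]qE normrM ler_peMr.
have : p%:Z ^+ L <= `|z + q|.
  have pL_ge0 : 0 <= p%:Z ^+ L by rewrite exprn_ge0.
  by rewrite wE normrM (ger0_norm pL_ge0) ler_peMl.
lia.
Qed.


(** Here [w] is R / P for b = 2 c, the common factor 2 cancelling. The bound K serves to produce
    infinitely many c, and the last clause makes the value irrational. *)
Lemma exists_partial_quotient (A A' B B' delta : rat) (q : int) (K : rat) :
    (2 < p)%N -> Z_inv_p p A -> Z_inv_p p A' -> Z_inv_p p B -> Z_inv_p p B' ->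
    A != 0 -> B != 0 -> pabs A' <= pabs A -> `|A' / A| < p%:R / 4 ->
    delta = A * B' - A' * B -> delta ^+ 2 = 1 ->
    (prime_to_p_part p B %| q)%Z -> (q %| prime_to_p_part p B ^+ 2)%Z ->
    in_powers_mod p (prime_to_p_part p A ^+ 2) q ->
  exists c, [/\ Z_inv_p p c, `|c| < p%:R / 4, K < pabs c,
    exists2 w, Z_inv_p p w & B * (c * B + B') = w * (A * (c * A + A')) &
    forall r, r ^+ 2 * (B * (c * B + B')) != A * (c * A + A')].
Proof.
move=> p2 AZ A'Z BZ B'Z A0 B0 A'A A'A4 dE d2 Bq qB qpow.
set At := prime_to_p_part p A in qpow; set Bt := prime_to_p_part p B in Bq qB.
have [] := prime_to_p_partP p_pr AZ A0; rewrite -/At.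
move: (padic_val p A) => vA AE pA.
have [] := prime_to_p_partP p_pr BZ B0; rewrite -/Bt.
move: (padic_val p B) => vB BE pB.
have pq : ~~ (p%:Z %| q)%Z.
  by apply: contra pB => /dvdz_trans/(_ qB); rewrite !dvdzE abszX Euclid_dvdX //= andbT.
have pA2 : ~~ (p%:Z %| At ^+ 2)%Z.
  by rewrite dvdzE abszX Euclid_dvdX //= andbT -[(p %| _)%N](dvdzE p).
have q0 : q != 0 by apply: contraNneq pq => ->; rewrite dvdz0.
have qR0 : q%:~R != 0 :> rat by rewrite intr_eq0.
have Bt0 : Bt%:~R != 0 :> rat by apply: contra_neq B0 => e; rewrite BE e mul0r.
have At0 : At%:~R != 0 :> rat by apply: contra_neq A0 => e; rewrite AE e mul0r.
have d0 : delta != 0 by apply: contra_eq_neq d2 => ->; rewrite expr0n.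
have dZ : Z_inv_p p delta.
  by rewrite dE; apply: (Z_inv_pD p_pr) => //; [|apply: Z_inv_pN]; apply: Z_inv_pM.
have d1 : pabs delta = 1.
  by apply/eqP; rewrite -sqrp_eq1 ?padic_abs_ge0 // -padic_absX // d2 padic_abs1.
have nd1 : `|delta| = 1 by apply/eqP; rewrite -sqrp_eq1 // -normrX d2 normr1.
pose gap := p%:R / 4 - `|A' / A|; have gap0 : 0 < gap by rewrite subr_gt0.
(* In turn, p^L > u1 ensures |c|_p > K, u2 that |e|_p > |A'|_p, u3 that |e / A| stays below [gap],
   and u4 that p^L > 3 |q|. *)
pose u1 := (`|K| + 1) * pabs A * pabs B; pose u2 := pabs A * pabs B.
pose u3 := `|q%:~R / (A * B)| / gap; pose u4 : rat := 3 * `|q%:~R|.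
have [u1_ge0 u2_ge0] : 0 <= u1 /\ 0 <= u2.
  by split; rewrite /u1 /u2 !mulr_ge0 ?padic_abs_ge0 ?addr_ge0.
have [u3_ge0 u4_ge0] : 0 <= u3 /\ 0 <= u4.
  by split; rewrite /u3 /u4 ?divr_ge0 ?mulr_ge0 // ltW.
have [L0 L0big] := ltr_exp_prime p_pr (u1 + u2 + u3 + u4).
have [L LL0 NL] := power_congr_unbounded L0 pA2 qpow.
have {L0 L0big LL0} Lbig : u1 + u2 + u3 + u4 < p%:R ^+ L.
  by apply: lt_le_trans L0big _; rewrite ler_eXn2l.
have pL0 : p%:R ^+ L != 0 :> rat by rewrite expf_neq0.
pose e := - delta * q%:~R / (p%:R ^+ L * B).
have e0 : e != 0 by rewrite /e !(mulf_neq0, invr_neq0) ?oppr_eq0.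
have eabs : pabs e = p%:R ^+ L / pabs B.
  rewrite /e !padic_absM // padic_absV // padic_absM // padic_absN // d1 mul1r.
  by rewrite padic_abs_int_eq1 // mul1r padic_absX // padic_abs_p // exprVn invfM invrK.
have pv0 (k : int) : p%:R ^ k != 0 :> rat by rewrite expfz_neq0.
have pzZ (k : int) : Z_inv_p p (p%:R ^ k) by apply: Z_inv_p_pz.
have intZ (k : int) : Z_inv_p p k%:~R by apply: Z_inv_p_int.
have ndZ : Z_inv_p p (- delta) by apply: Z_inv_pN.
(* The prime-to-p part of B divides q, so only powers of p remain in the denominator. *)
have eZ : Z_inv_p p e.
  have [k qk] := dvdzP Bq.
  have -> : e = - delta * k%:~R * (p%:R ^ (- L%:Z) * p%:R ^ (- vB)).
    rewrite /e BE qk rmorphM /= -!invr_expz -exprnP.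
    by field; rewrite pL0 Bt0 pv0.
  by do !apply: Z_inv_pM => //.
pose c := (e - A') / A; pose g := delta * (p%:R ^+ L - q%:~R) / (p%:R ^+ L * A).
have cA : c * A + A' = e by rewrite /c divfK // subrK.
have cB : c * B + B' = g.
  have -> : c * B + B' = (e * B + (A * B' - A' * B)) / A by rewrite /c; field.
  by rewrite -dE /e /g; field; rewrite A0 pL0 B0.
(* Two factors [At] have to cancel, one from g and one from the division by A; hence the congruence
   modulo the square. *)
have gZ : Z_inv_p p (g / A).
  have [k /(congr1 (fun z => z%:~R : rat))] := dvdzP NL.
  rewrite rmorphB rmorphM !rmorphXn /= -pmulrn => qk.
  have -> : g / A = delta * k%:~R * (p%:R ^ (- L%:Z) * (p%:R ^ (- vA) * p%:R ^ (- vA))).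
    rewrite /g qk AE -!invr_expz -exprnP.
    by field; rewrite pL0 At0 pv0.
  by do !apply: Z_inv_pM => //.
have cZ : Z_inv_p p c.
  (* Since c delta = (c A) B' - A' (c B) and delta^2 = 1, c is a polynomial in elements of Z[1/p],
     without division by A. *)
  have -> : c = delta * ((e - A') * B' - A' * (g - B')).
    rewrite -cA -cB -[LHS]mul1r -d2 expr2 -[LHS]mulrA {2}dE.
    by ring.
  apply: Z_inv_pM => //; apply: (Z_inv_pD p_pr); last apply: Z_inv_pN.
    by apply: Z_inv_pM => //; apply: (Z_inv_pD p_pr) => //; apply: Z_inv_pN.
  apply: Z_inv_pM => //; apply: (Z_inv_pD p_pr); last exact: Z_inv_pN.
  by rewrite -[g](divfK A0); apply: Z_inv_pM.
have [pA0 pB0] : 0 < pabs A /\ 0 < pabs B by rewrite !padic_abs_gt0.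
exists c; split=> //.
- have -> : c = e / A - A' / A by rewrite /c mulrBl.
  apply: le_lt_trans (ler_normB _ _) _.
  rewrite -ltrBrDr -/gap.
  have -> : e / A = - delta * (q%:~R / (A * B)) / p%:R ^+ L.
    by rewrite /e; field; rewrite A0 pL0 B0.
  rewrite normrM normfV normrX (ger0_norm (ltW p_gt0)) normrM normrN nd1 mul1r.
  rewrite ltr_pdivrMr ?exprn_gt0 // (mulrC gap) -ltr_pdivrMr //.
  by apply: le_lt_trans Lbig; rewrite -/u3; lra.
- rewrite /c padic_absM // padic_absV // (padic_absDl p_pr); last first.
    rewrite padic_absN // eabs; apply: (le_lt_trans A'A).
    by rewrite ltr_pdivlMr //; apply: le_lt_trans Lbig; rewrite -/u2; lra.
  rewrite eabs !ltr_pdivlMr // mulrAC.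
  apply: (@le_lt_trans _ _ u1); last by apply: le_lt_trans Lbig; lra.
  rewrite /u1 -mulrA [pabs B * _]mulrC -mulrA ler_wpM2r ?mulr_ge0 ?padic_abs_ge0 //.
  by apply: le_trans (ler_norm K) _; rewrite lerDl.
(* B / e equals - B^2 p^L / (delta q), and q divides the square of the prime-to-p part of B. *)
- exists (B / e * (g / A)); last by rewrite cA cB; field; rewrite e0 A0.
  apply: Z_inv_pM => //; have [k /(congr1 (fun z => z%:~R : rat))] := dvdzP qB.
  rewrite [in RHS]rmorphM rmorphXn /= => qk.
  have dV : delta^-1 = delta by rewrite -[LHS]mulr1 -d2; field.
  have -> : B / e =
      - delta^-1 * (Bt%:~R ^+ 2 / q%:~R) * (p%:R ^ vB * p%:R ^ vB) * p%:R ^+ L.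
    by rewrite /e BE; field; rewrite d0 qR0 Bt0 pL0 pv0.
  rewrite dV qk mulfK //.
  by do !apply: Z_inv_pM => //; exact: (pzZ L).
move=> r; apply/eqP; rewrite cA cB => rE.
(* Multiplying A e / (B g), which would be r^2, by the square of B (q - p^L) / A gives q (q -
   p^L). *)
pose y := r * B * (q%:~R - p%:R ^+ L) / A.
have [|z zE] := @rat_sqr_int y (q * (q - p%:Z ^+ L)).
  have -> : y ^+ 2 =
      r ^+ 2 * (B * g) * (p%:R ^+ L * B * (p%:R ^+ L - q%:~R) / (delta * A)).
    by rewrite /y /g; field; rewrite A0 pL0 d0.
  rewrite rE /e rmorphM rmorphB rmorphXn /= -pmulrn.
  by field; rewrite A0 pL0 d0 B0.
suff qL : 3 * `|q| < p%:Z ^+ L.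
  by have := shifted_square_not_square z p2 pq qL; rewrite -zE eqxx.
rewrite -(ltr_int rat) rmorphM rmorphXn /= -pmulrn intr_norm.
by apply: le_lt_trans Lbig; rewrite -/u4; lra.
Qed.

End Arithmetic.

(** * Values of symmetric expansions *)

Section Main.
Variables (p : nat) (p_pr : prime p).
Hypothesis p_gt2 : (2 < p)%N.
Local Notation pabs := (padic_abs p).
Local Notation f := (rat_padic p_pr).

Let p_gt0 : 0 < p%:R :> rat. Proof. by rewrite ltr0n prime_gt0. Qed.
Let p_neq0 : p%:R != 0 :> rat. Proof. by rewrite lt0r_neq0. Qed.

Lemma padic_abs2 : pabs 2 = 1.
Proof. by apply: (padic_abs_int_eq1 p_pr (a := 2)); rewrite dvdzE /= gtnNdvd. Qed.

(** As p is odd, |2 a_0|_p = |a_0|_p, so every partial quotient has absolute value above 1. The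
    quadratic form is constant along the multiples of 2 t, which are arbitrarily large. *)
Lemma symmetric_cf_value (s : seq rat) (b : rat)
    (A := cf_num (nth 0 s) (size s)) (A' := cf_num (nth 0 s) (size s).-1)
    (B := cf_den (nth 0 s) (size s)) (B' := cf_den (nth 0 s) (size s).-1) :
    (0 < size s)%N -> {in s, forall y, 1 < pabs y} -> 1 < pabs b ->
  exists x, cf_value (p_pr := p_pr) (symmetric_cf s b) x /\
    f (B * (b * B + 2 * B')) * x ^+ 2 = f (A * (b * A + 2 * A')).
Proof.
move=> s0 s1 b1; have a1 i : 1 < pabs (symmetric_cf s b i).
  have := symmetric_cf_mem b s0 i; rewrite mem_cat !inE.
  case/or3P => [/s1//|/eqP->//|/eqP->].
  by rewrite padic_absM // padic_abs2 mul1r s1 // mem_nth.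
have [x [ax ux]] := cf_converges p_pr (fun i _ => a1 i).
exists x; split=> //; apply: (cf_limit_root a1 ux) => N.
exists (N * (size s).*2)%N; last exact: symmetric_cf_form_invariant.
by rewrite leq_pmulr // double_gt0.
Qed.

Lemma field_inv_sqrt (F : fieldType) (x z v : F) : z != 0 -> v * x ^+ 2 = 1 ->
  (1 / (z * x)) ^+ 2 = v / (z * z) /\ x = 1 / (z * (1 / (z * x))).
Proof.
move=> z0 vx; have x0 : x != 0.
  by apply/eqP => x0; move/eqP: vx; rewrite x0 expr0n mulr0 eq_sym oner_eq0.
split; last by rewrite !div1r invfM invrK mulKf.
have -> : v = 1 / x ^+ 2 by rewrite -vx mulfK ?expf_neq0.
by field; rewrite z0 x0.
Qed.

(** Here [w] is 1 / x^2, and m = w / p^(2 k) is an integer because it lies in Z[1/p] and has p-adic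
    absolute value 1; its square root is 1 / (p^k x). *)
Lemma inv_sqrt_form (P R w : rat) (k : int) (x : padic p_pr) :
    f R * x ^+ 2 = f P -> P != 0 -> R = w * P -> Z_inv_p p w ->
    pabs w = p%:R ^ (- (k + k)) -> (forall r, r ^+ 2 * R != P) ->
  quadratic_irrational x /\ exists (m : int) (y : padic p_pr),
    y ^+ 2 = m%:~R /\ x = 1 / (p%:R ^ k * y).
Proof.
move=> Rx P0 RwP wZ w_abs no_root.
have wx1 : f w * x ^+ 2 = 1.
  apply: (mulIf (x := f P)); first by rewrite fmorph_eq0.
  by rewrite mul1r -[RHS]Rx RwP rmorphM mulrAC.
split; last first.
  have [m wm] : exists m : int, w / (p%:R ^ k * p%:R ^ k) = m%:~R.
    apply: (Z_inv_p_integral p_pr).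
      by apply: Z_inv_pM => //; rewrite -expfzDr // invr_expz; apply: Z_inv_p_pz.
    rewrite padic_absM // w_abs padic_absV // padic_absM // padic_abs_pz //.
    by rewrite -expfzDr // -opprD mulfV // expfz_neq0.
  have pk0 : (p%:R ^ k : padic p_pr) != 0.
    by rewrite -(rmorph_nat f) -fmorphXz fmorph_eq0 expfz_neq0.
  have [yE xE] := field_inv_sqrt pk0 wx1.
  exists m, (1 / (p%:R ^ k * x)); split=> //; rewrite yE -(rmorph_int f) -wm.
  by rewrite fmorph_div rmorphM /= fmorphXz rmorph_nat.
split=> [r xr|].
  have {}xr : x = f r by [].
  case/eqP: (no_root r); apply: (fmorph_inj f).
  by rewrite rmorphM rmorphXn /= -xr mulrC.
exists ('X^2 - (w^-1)%:P); split; first by rewrite size_XnsubC.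
(* [rat_padic] replaces the convertible [ratr], since it carries the morphism structure. *)
change (root (map_poly f ('X^2 - (w^-1)%:P)) x).
rewrite rmorphB /= map_polyXn map_polyC /= rootE !hornerE fmorphV.
have fw0 : f w != 0.
  by apply/eqP => w0; move/eqP: wx1; rewrite w0 mul0r eq_sym oner_eq0.
by rewrite subr_eq0 -(inj_eq (mulfI fw0)) wx1 mulfV.
Qed.

Theorem exists_symmetric_partial_quotient (s : seq rat) (K : rat) :
    (0 < size s)%N -> finite_BCF p s -> nice_BCF p s ->
  exists b, [/\ K < pabs b, browkin_set p b,
    cvg_to_inv_sqrt p_pr (symmetric_cf s b) (- padic_val p s`_0) &
    exists c, browkin_set p c /\ b = 2 * c].
Proof.
move=> s0 [s_brow s_abs] [[a0_abs _] AA' [q [Bq qB qpow]]].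
set a := nth 0 s in AA' Bq qB qpow; set t := size s in AA' Bq qB qpow s0 s_brow s_abs.
have tE : t = t.-1.+1 by rewrite prednK.
set A := cf_num a t in AA' qpow; set A' := cf_num a t.-1 in AA'.
set B := cf_den a t in Bq qB qpow; pose B' := cf_den a t.-1.
have a1 i : (i <= t.-1)%N -> 1 < pabs (a i).
  by move=> it; case: i it => // i it; rewrite s_abs // tE.
have s1 : {in s, forall y, 1 < pabs y}.
  by move=> y /(nthP 0)[i it <-]; apply: a1; rewrite -ltnS -tE.
have [A0 A'A] : A != 0 /\ pabs A' <= pabs A by rewrite /A tE; apply: cf_num_incr.
have [B0 B'B] : B != 0 /\ pabs B' <= pabs B.
  by rewrite /B tE; apply: cf_den_incr => // i /andP[_]; apply: a1.
have AB : pabs A = pabs (a 0%N) * pabs B by rewrite /A /B tE; apply: pabs_cf_num.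
have aZ i : Z_inv_p p (a i).
  have [it|it] := ltnP i t; first by have [] := s_brow i it.
  (* Beyond the end of [s] the default value 0 is read. *)
  by rewrite /a nth_default //; apply: (Z_inv_p_int p 0).
have cfZ n : (Z_inv_p p (cf_num a n) /\ Z_inv_p p (cf_den a n)) /\
    (Z_inv_p p (cf_num a n.+1) /\ Z_inv_p p (cf_den a n.+1)).
  have Z0 : Z_inv_p p 0 := Z_inv_p_int p 0; have Z1 : Z_inv_p p 1 := Z_inv_p_int p 1.
  elim: n => [|n [[num0 den0] [num1 den1]]]; first by do !split=> //; apply: aZ.
  split; first by split.
  rewrite cf_numS cf_denS; split; by apply: (Z_inv_pD p_pr) => //; apply: Z_inv_pM.
have [[[A'Z B'Z] _] [[AZ BZ] _]] := (cfZ t.-1, cfZ t).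
rewrite -/A -/A' -/B -/B' in A'Z B'Z AZ BZ.
have det2 : (A * B' - A' * B) ^+ 2 = 1.
  have := cf_det a t.-1; rewrite prednK // => ->.
  by rewrite -exprM mulnC exprM sqrrN !expr1n.
(* The lower bound 4 / p of the niceness condition, inverted; it leaves room for |c| below p / 4,
   hence for |2 c| below p / 2. *)
have A'A4 : `|A' / A| < p%:R / 4.
  rewrite -[A' / A]invf_div normfV -[p%:R / 4]invf_div ltf_pV2 ?posrE ?divr_gt0 //.
  by apply: lt_trans AA'; rewrite divr_gt0.
(* The bound |K| + 1 gives |c|_p > 1 as well as |c|_p > K. *)
have [c [cZ c4 cK [w wZ RwP] no_root]] := exists_partial_quotient p_pr
  (`|K| + 1) p_gt2 AZ A'Z BZ B'Z A0 B0 A'A A'A4 erefl det2 Bq qB qpow.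
have c1 : 1 < pabs c by apply: le_lt_trans cK; rewrite lerDr.
have bc : pabs (2 * c) = pabs c by rewrite padic_absM // padic_abs2 mul1r.
have [x [ax Rx]] := @symmetric_cf_value s (2 * c) s0 s1 (eq_ind_r (fun y => 1 < y) c1 bc).
rewrite -/a -/t -/A -/A' -/B -/B' in Rx.
have P0 : c * A + A' != 0.
  rewrite -(padic_abs_eq0 p_pr) pabs_recurrence // gt_eqF // mulr_gt0 //.
  - exact: lt_trans c1.
  by rewrite padic_abs_gt0.
have twoZ : Z_inv_p p 2 by apply: (Z_inv_p_int p 2).
exists (2 * c); split.
- by rewrite bc; apply: lt_trans cK; apply: le_lt_trans (ler_norm K) _; rewrite ltrDl.
- split; first exact: Z_inv_pM.
  by move: c4; rewrite ltr_norml => /andP[]; lra.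
- have PE : A * (2 * c * A + 2 * A') = 2 * (A * (c * A + A')) by ring.
  have RE : B * (2 * c * B + 2 * B') = 2 * (B * (c * B + B')) by ring.
  rewrite PE RE in Rx.
  have [||||xQ xm] := inv_sqrt_form (k := - padic_val p s`_0) Rx _ _ wZ; last by exists x.
  + by rewrite !mulf_neq0.
  + by rewrite RwP; ring.
  (* The leading terms give |c|_p |B|_p^2 = |w|_p |c|_p |A|_p^2; with |A|_p = |a_0|_p |B|_p this
     means |w|_p = |a_0|_p^(-2) = p^(-2 k_0). *)
  + have := congr1 (padic_abs p) RwP.
    rewrite !padic_absM // !pabs_recurrence // AB => wabs.
    have a00 : a 0%N != 0 by rewrite -(padic_abs_eq0 p_pr) gt_eqF // (lt_trans ltr01) ?a1.
    have {}wabs : pabs w * (pabs (a 0%N) * pabs (a 0%N)) = 1.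
      have U : pabs B * (pabs c * pabs B) != 0.
        have c0 : c != 0 by rewrite -(padic_abs_eq0 p_pr) gt_eqF // (lt_trans ltr01).
        by rewrite !mulf_neq0 ?padic_abs_eq0.
      by apply: (mulIf U); rewrite mul1r [RHS]wabs; ring.
    apply: (mulIf (x := pabs (a 0%N) * pabs (a 0%N))).
      by rewrite mulf_neq0 ?padic_abs_eq0.
    rewrite wabs padic_abs_neq0 // -!expfzDr //.
    by rewrite addNr.
  move=> r; have := no_root r; apply: contra_neq => e.
  by apply: (@mulfI _ 2) => //; rewrite -e; ring.
exists c; split=> //; split=> //.
by move: c4; rewrite ltr_norml => /andP[]; lra.
Qed.

End Main.

(** On a finite set a nonnegative function is bounded by the sum of its values. *)
Lemma infinite_set_unbounded (S : set rat) (g : rat -> rat) :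
  (forall x, 0 <= g x) -> (forall K, exists2 x, S x & K < g x) -> infinite_set S.
Proof.
move=> g0 unbounded /finite_seqP[l Sl].
have [x] := unbounded (\sum_(y <- l) g y); rewrite Sl /= => xl.
by rewrite (big_rem x) //= ltNge lerDl sumr_ge0.
Qed.

Unset Implicit Arguments.

Theorem theorem5p6 (p : nat) (p_pr : prime p) (p_gt2 : (2 < p)%N)
    (s : seq rat) (s_nonempty : (0 < size s)%N)
    (s_BCF : finite_BCF p s) (s_nice : nice_BCF p s) :
  let k0 : int := - padic_val p s`_0 in
  infinite_set [set b : rat | browkin_set p b /\
    cvg_to_inv_sqrt p_pr (symmetric_cf s b) k0] /\
  infinite_set [set b : rat | [/\ browkin_set p b,
    cvg_to_inv_sqrt p_pr (symmetric_cf s b) k0 &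
    exists c : rat, browkin_set p c /\ b = 2 * c]].
Proof.
move=> k0; split; apply: (infinite_set_unbounded (padic_abs_ge0 p_pr)) => K;
  have [b [Kb b_brow b_cvg b_even]] :=
    exists_symmetric_partial_quotient p_pr p_gt2 K s_nonempty s_BCF s_nice;
  by exists b.
Qed.
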